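(* Let $1\le d\le 5$ and let $\omega$ be a weight function on $F_d$ such that the weighted graph $(F_d,\omega)$ has minimum degree at least $5/14$, i.e. $\omega(N(v))\ge 5/14$ for every vertex $v$. Then $(F_d,\omega)$ has a sparse half.
   Context: For an integer $d\ge1$, $F_d$ is the graph with vertex set $\{v_1,\dots,v_{3d-1}\}$ in which $v_j$ is adjacent to $v_{j+d},\dots,v_{j+2d-1}$, indices modulo $3d-1$. A weight function on a graph $G$ is a map $\omega:V(G)\to(0,1)$ with $\sum_v\omega(v)=1$; $\omega(X)=\sum_{x\in X}\omega(x)$, and $N(v)$ is the neighbourhood of $v$. A half of $(G,\omega)$ is a function $s:V(G)\to\mathbb{R}_{\ge0}$ with $s(v)\le\omega(v)$ for all $v$ and $\sum_v s(v)=1/2$; it is a sparse half if $\sum_{uv\in E(G)}s(u)s(v)\le 1/50$. *)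

(* Defs.v *)
From mathcomp Require Import all_boot all_order all_algebra reals.
From mathcomp Require Import zify.

Set Implicit Arguments.
Unset Strict Implicit.
Unset Printing Implicit Defensive.

Import Order.TTheory GRing.Theory Num.Theory.
Local Open Scope ring_scope.

(* The vertex v_j of F_d is the residue of j modulo 3d - 1; the neighbours of
   v_j are v_(j+d+k) for 0 <= k < d. *)
Definition F_adj (d : nat) : rel 'I_(3 * d - 1) :=
  fun i j => [exists k : 'I_d, (j : nat) == ((i + d + k) %% (3 * d - 1))%N].

Lemma F_adj_sym (d : nat) : symmetric (@F_adj d).
Proof.
suff H (i j : 'I_(3 * d - 1)) : F_adj i j -> F_adj j i.
  by move=> i j; apply/idP/idP; apply: H.
case/existsP=> k /eqP jE; apply/existsP.
have kd := ltn_ord k; have il := ltn_ord i.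
have k'd : (d - 1 - k < d)%N by lia.
exists (Ordinal k'd); apply/eqP => /=.
rewrite jE -addnA modnDml.
have -> : (i + d + k + (d + (d - 1 - k)) = i + (3 * d - 1))%N by lia.
by rewrite modnDr modn_small.
Qed.

Lemma F_adj_irr (d : nat) : irreflexive (@F_adj d).
Proof.
move=> i; apply/negbTE/existsP => -[k /eqP iE].
have kd := ltn_ord k; have il := ltn_ord i.
have lt : (d + k < 3 * d - 1)%N by lia.
have : (i + 0 == i + (d + k) %[mod 3 * d - 1])%N.
  by rewrite addn0 addnA -iE modn_small.
by rewrite eqn_modDl mod0n modn_small //; lia.
Qed.

Section WeightedGraphs.
Variables (R : realType) (V : finType) (E : rel V).
Implicit Types (w s : V -> R).

Definition nbhd (v : V) : {set V} := [set u | E v u].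

Definition edges : {set {set V}} := [set [set p.1; p.2] | p in [pred p : V * V | E p.1 p.2]].

Definition weight w (X : {set V}) : R := \sum_(x in X) w x.

Definition is_weight w : Prop :=
  (forall v, 0 < w v < 1) /\ \sum_v w v = 1.

Definition min_degree_ge w (c : R) : Prop :=
  forall v, c <= weight w (nbhd v).

Definition is_half w s : Prop :=
  (forall v, 0 <= s v <= w v) /\ \sum_v s v = 1 / 2.

(* For E irreflexive every edge is a two-element set {u, v}, so the product
   over the edge is s(u) s(v), and each edge is counted once. *)
Definition is_sparse_half w s : Prop :=
  is_half w s /\ \sum_(e in edges) \prod_(x in e) s x <= 1 / 50.

End WeightedGraphs.

(* Main.v *)
Require Import Defs.
From mathcomp Require Import all_boot all_order all_algebra reals.
From mathcomp Require Import boolp zify ring lra.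

(** The neighbourhoods of F_d are exactly its arcs of d consecutive vertices, so
    in units of 1/14 every d-arc weighs at least 5. Removing two disjoint d-arcs
    leaves a (d-1)-arc of weight at most 4, hence every vertex weighs at least 1.
    Halves are sought on d+1 or d+2 consecutive vertices, which span one,
    respectively three, edges.

    - d = 2: average, over the five rotations, the half consisting of two
      consecutive vertices and part of the next one.
    - d = 3: of two complementary 4-arcs one weighs at least 7. If both extreme
      halves of such an arc fail, the pairs of numbers whose product is the edge
      sum lie in the convex set s t > 98/25, and tangents to the hyperbola give
      linear inequalities. These are contradictory for each choice of one arc
      from each of the four complementary pairs.
    - d = 4: if no 5-arc weighs 7 or more, average over the eleven rotations.
      Otherwise the two ends of a heavy 5-arc have weight almost 2, which nearly
      determines the weights, and a 6-arc at one of these ends works.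
    - d = 5: all weights equal 1 and any seven consecutive vertices work. *)

Set Implicit Arguments.
Unset Strict Implicit.
Unset Printing Implicit Defensive.

Import Order.TTheory GRing.Theory Num.Theory.
Local Open Scope ring_scope.

(** * Edge sums and the cyclic structure of F_d *)

Lemma edge_sum (R : realType) (V : finType) (E : rel V) (s : V -> R) :
  irreflexive E -> symmetric E ->
  \sum_(e in edges E) \prod_(x in e) s x
  = (\sum_u \sum_(v | E u v) s u * s v) / 2.
Proof.
move=> Eirr Esym; rewrite pair_big_dep /=.
(* Group the ordered pairs by the edge they span: each fibre is exactly (u, v) and (v, u), which
   explains the factor 2. *)
rewrite (partition_big (fun p : V * V => [set p.1; p.2]) (mem (edges E))) /=;
  last by move=> p Ep; apply/imsetP; exists p.
rewrite mulr_suml; apply: eq_bigr => _ /imsetP[[u v] /= Euv ->].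
have uv : u != v by apply: contraTneq Euv => ->; rewrite inE /= Eirr.
rewrite big_setU1 ?inE //= big_set1.
rewrite (bigD1 (u, v)) /=; last by rewrite eqxx andbT.
rewrite (bigD1 (v, u)) /=; last first.
  by rewrite Esym setUC eqxx andbT xpair_eqE negb_and (eq_sym v) uv !andbT.
rewrite big1 ?addr0; first by rewrite (mulrC (s v)); field.
move=> [a b] /= /andP[/andP[/andP[_ /eqP /setP eab]]].
have /= := eab u; have /= := eab v; have /= := eab a; have /= := eab b.
rewrite !inE !eqxx ?orbT /= !xpair_eqE.
rewrite (eq_sym u a) (eq_sym u b) (eq_sym v a) (eq_sym v b).
by case: (a == u); case: (b == u); case: (a == v); case: (b == v).
Qed.

Lemma sum_ord_eqn (R : nzRingType) (n q : nat) : (q < n)%N ->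
  \sum_(b < n) (b == q :> nat)%:R = 1 :> R.
Proof.
move=> qn; rewrite (bigD1 (Ordinal qn)) //= eqxx big1 ?addr0 // => b.
by rewrite -val_eqE /= => /negbTE ->.
Qed.

(** Going round the other way replaces a difference x by 3d - 1 - x, and this maps the range from d
    to 2d - 1 onto itself; so the modulus disappears. *)
Lemma F_adjE (d : nat) (a b : 'I_(3 * d - 1)) :
  F_adj a b = (d <= b - a < d.*2)%N || (d <= a - b < d.*2)%N.
Proof.
have lt (u v : 'I_(3 * d - 1)) : (u < v)%N -> F_adj u v = (d <= v - u < d.*2)%N.
  move=> uv; have vn := ltn_ord v; apply/existsP/idP => [[k /eqP e]|h].
    have kd := ltn_ord k.
    have : (u + (v - u) == u + (d + k) %[mod 3 * d - 1])%N.
      by rewrite addnA -e subnKC 1?modn_small // ltnW.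
    by rewrite eqn_modDl !modn_small; lia.
  have kd : (v - u - d < d)%N by lia.
  exists (Ordinal kd) => /=; rewrite modn_small; lia.
case: (ltngtP a b) => h.
- by rewrite lt //; lia.
- by rewrite F_adj_sym lt //; lia.
- have -> : a = b by apply/val_inj.
  by rewrite F_adj_irr subnn; have := ltn_ord b; lia.
Qed.

(** Periodic extension to [nat], so that an arc is an interval of indices even where it wraps
    around. *)
Definition cyc (R : Type) (n : nat) (npos : (0 < n)%N) (w : 'I_n -> R) (j : nat) : R :=
  w (Ordinal (ltn_pmod j npos)).

Lemma cycD (R : Type) (n : nat) (npos : (0 < n)%N) (w : 'I_n -> R) (j : nat) :
  cyc npos w (j + n) = cyc npos w j.
Proof. by congr w; apply/val_inj => /=; rewrite modnDr. Qed.

Lemma rot_ord_inj (n i : nat) (npos : (0 < n)%N) :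
  injective (fun k : 'I_n => Ordinal (ltn_pmod (i + k) npos)).
Proof.
move=> a b [/eqP]; rewrite eqn_modDl !modn_small // => /eqP; exact: val_inj.
Qed.

Lemma nbhd_cyc (R : realType) (d : nat) (npos : (0 < 3 * d - 1)%N)
    (w : 'I_(3 * d - 1) -> R) (v : 'I_(3 * d - 1)) :
  weight w (nbhd (@F_adj d) v) = \sum_(k < d) cyc npos w (v + d + k).
Proof.
pose f (k : 'I_d) : 'I_(3 * d - 1) := Ordinal (ltn_pmod (v + d + k) npos).
have finj : injective f.
  move=> a b [/eqP]; have ? := ltn_ord a; have ? := ltn_ord b.
  by rewrite eqn_modDl !modn_small; [move/eqP/val_inj|lia|lia].
rewrite /weight (_ : nbhd _ v = f @: setT); last first.
  apply/setP => u; rewrite inE; apply/existsP/imsetP => [[k /eqP e]|[k _ ->]].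
    by exists k => //; apply/val_inj.
  by exists k.
by rewrite big_imset /=; [apply: eq_bigl => k; rewrite inE | move=> ? ? _ _; apply: finj].
Qed.

(** The three edges within d + 2 consecutive vertices, each in both orders. As a sum of indicators
    the double sum over a and b collapses term by term; the final 0 matches the unfolding of a sum
    over a list. *)
Lemma arc_edges (d a b : nat) : (2 <= d)%N -> (a < d.+2)%N -> (b < d.+2)%N ->
  ((d <= b - a < d.*2) || (d <= a - b < d.*2) : nat)%N =
  ((a == 0) && (b == d) + ((a == 0) && (b == d.+1) + ((a == 1) && (b == d.+1)
    + ((a == d) && (b == 0) + ((a == d.+1) && (b == 0) + ((a == d.+1) && (b == 1)
    + 0))))))%N.
Proof.
case: d => [|[|d]] // _; case: a => [|[|a]] ha; case: b => [|[|b]] hb.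
all: rewrite /= ?eqSS ?andbF ?andbT ?orbF ?addn0 ?add0n ?subn0 ?sub0n ?subSS.
all: lia.
Qed.

Lemma arc_sparse_half (R : realType) (d : nat) (npos : (0 < 3 * d - 1)%N)
    (w : 'I_(3 * d - 1) -> R) (i : nat) (c : seq R) :
  (2 <= d)%N -> size c = d.+2 -> (forall v, 0 <= w v) ->
  (forall k, (k < d.+2)%N -> 0 <= c`_k <= cyc npos w (i + k)) ->
  \sum_(k < d.+2) c`_k = 1 / 2 ->
  c`_0 * c`_d + c`_0 * c`_d.+1 + c`_1 * c`_d.+1 <= 1 / 50 ->
  exists s, is_sparse_half (@F_adj d) w s.
Proof.
move=> d2 sc w0 cw c_sum cost.
have rinj := @rot_ord_inj _ i npos.
(* Vertex i + k receives entry k of [c]; beyond the end of [c] the default 0 of [nth] makes the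
   function vanish off the arc. *)
exists (fun v => c`_(invF rinj v)); split; first split.
- move=> v; case: (ltnP (invF rinj v) d.+2) => h.
    have := cw _ h; rewrite /cyc.
    by have /= -> := f_invF rinj v.
  by rewrite nth_default ?sc // lexx w0.
- rewrite (reindex_inj rinj) /=; under eq_bigr => k _ do rewrite (invF_f rinj).
  rewrite -c_sum; have le : (d.+2 <= 3 * d - 1)%N by lia.
  rewrite (big_ord_widen _ (fun k => c`_k) le) [RHS]big_mkcond /=.
  by apply: eq_bigr => k _; case: ltnP => // h; rewrite nth_default ?sc.
apply: le_trans cost; rewrite edge_sum; [|exact: F_adj_irr|exact: F_adj_sym].
rewrite (reindex_inj rinj) /=.
under eq_bigr => a _.
  rewrite (reindex_inj rinj) big_mkcond /=.
  under eq_bigr => b _.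
    rewrite !(invF_f rinj).
    have -> : F_adj (Ordinal (ltn_pmod (i + a) npos)) (Ordinal (ltn_pmod (i + b) npos))
        = F_adj a b.
      rewrite /F_adj; apply/eq_existsb => k /=.
      by rewrite -(addnA _ d) modnDml -addnA eqn_modDl [(b %% _)%N]modn_small // addnA.
    have -> : (if F_adj a b then c`_a * c`_b else 0) =
      \sum_(p <- [:: (0, d); (0, d.+1); (1, d.+1); (d, 0); (d.+1, 0); (d.+1, 1)]%N)
        (a == p.1 :> nat)%:R * (b == p.2 :> nat)%:R * (c`_p.1 * c`_p.2).
      under eq_bigr => p _.
        have -> : (a == p.1 :> nat)%:R * (b == p.2 :> nat)%:R * (c`_p.1 * c`_p.2)
            = ((a == p.1 :> nat) && (b == p.2 :> nat))%:R * (c`_a * c`_b).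
          by case: eqP => [->|]; case: eqP => [->|] //=; rewrite ?(mul0r, mulr0, mul1r).
        over.
      rewrite -mulr_suml -natr_sum !big_cons big_nil /= F_adjE.
      case: (ltnP a d.+2) => ha; last first.
        by rewrite (nth_default _ (n := a)) ?sc // mul0r mulr0 if_same.
      case: (ltnP b d.+2) => hb; last first.
        by rewrite (nth_default _ (n := b)) ?sc // !mulr0 if_same.
      rewrite -[in LHS](mul1r (_ * _)) -[LHS]mulrb -mulrnAl; congr (_%:R * _).
      by rewrite arc_edges.
    over.
  rewrite exchange_big /=; over.
rewrite exchange_big /= !big_cons big_nil /=.
have sumE p q (K : R) : (p < 3 * d - 1)%N -> (q < 3 * d - 1)%N ->
  \sum_(a < 3 * d - 1) \sum_(b < 3 * d - 1) (a == p :> nat)%:R * (b == q :> nat)%:R * K = K.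
  move=> pn qn; under eq_bigr => a _.
    rewrite -mulr_suml -mulr_sumr sum_ord_eqn // mulr1; over.
  by rewrite -mulr_suml sum_ord_eqn // mul1r.
rewrite !sumE; try lia.
lra.
Qed.

(** * Tangents to the hyperbola s t = 98/25 and the linear system for d = 3 *)

(** The line b s + a t = 2k is the tangent to s t = k at (a, b). By AM-GM, (b s + a t)^2 >= 4 a b s
    t > 4 k^2. *)
Lemma hyperbola_tangent (R : realFieldType) (k a b s t : R) :
  k < s * t -> 0 < a -> 0 < b -> 0 <= s -> 0 <= t -> k = a * b ->
  2 * k < b * s + a * t.
Proof.
move=> st a0 b0 s0 t0 kE; have k0 : 0 < k by rewrite kE mulr_gt0.
rewrite ltNge; apply/negP => le.
have bs0 : 0 <= b * s + a * t by rewrite addr_ge0 // mulr_ge0 // ltW.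
have le2 : (b * s + a * t) ^+ 2 <= (2 * k) ^+ 2 by rewrite ler_sqr ?nnegrE //; lra.
have amgm : 4 * k * (s * t) <= (b * s + a * t) ^+ 2.
  by rewrite kE -subr_ge0 (_ : _ - _ = (b * s - a * t) ^+ 2) ?sqr_ge0 //; ring.
have : 4 * k * k < 4 * k * (s * t) by rewrite ltr_pM2l // mulr_gt0.
lra.
Qed.

(** Tangent at (49/25, 2). Where it is applied one has t <= 2, and then it yields the sharp bound s
    > 49/25. *)
Lemma tangent_near_l (R : realFieldType) (s t : R) :
  98 / 25 < s * t -> 0 <= s -> 0 <= t -> 196 < 50 * s + 49 * t.
Proof.
by move=> st s0 t0; have := @hyperbola_tangent R _ (49 / 25) 2 s t st; lra.
Qed.

Lemma tangent_near_r (R : realFieldType) (s t : R) :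
  98 / 25 < s * t -> 0 <= s -> 0 <= t -> 196 < 49 * s + 50 * t.
Proof. by move=> st s0 t0; rewrite addrC tangent_near_l // (mulrC t). Qed.

(** Tangent at (14/5, 7/5), effective when s is well above t. *)
Lemma tangent_far (R : realFieldType) (s t : R) :
  98 / 25 < s * t -> 0 <= s -> 0 <= t -> 28 < 5 * s + 10 * t.
Proof.
by move=> st s0 t0; have := @hyperbola_tangent R _ (14 / 5) (7 / 5) s t st; lra.
Qed.

(* Weights are scaled by 14, so that half of the total is 7 and the bound 1/50
   on the edge sum becomes 196/50 = 98/25. The list c is a candidate half on
   the vertices i, ..., i+d+1, whose only edges join positions 0 and d, 0 and
   d+1, 1 and d+1. *)
Definition arc_criterion (R : realFieldType) (d : nat) (z : nat -> R) (P : Prop) :=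
  forall (i : nat) (c : seq R), size c = d.+2 ->
  (forall k, (k < d.+2)%N -> 0 <= c`_k <= z (i + k)%N) ->
  \sum_(k < d.+2) c`_k = 7 ->
  c`_0 * c`_d + c`_0 * c`_d.+1 + c`_1 * c`_d.+1 <= 98 / 25 -> P.

(* Linear consequences of the failure of both extreme halves of a heavy arc
   with weights a, b, c, d in F_3. *)
Definition arc3_bad (R : realFieldType) (a b c d : R) : Prop :=
  [/\ 19 < 10 * a, 19 < 10 * d, 10 * (b + c) < 31, 5 * a + 10 * (b + c) < 42 &
      5 * d + 10 * (b + c) < 42].

Lemma arc3_bad_absurd (R : realFieldType) (z0 z1 z2 z3 z4 z5 z6 z7 : R) :
  1 <= z0 -> 1 <= z1 -> 1 <= z2 -> 1 <= z3 -> 1 <= z4 -> 1 <= z5 -> 1 <= z6 -> 1 <= z7 ->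
  z0 + z1 + z2 + z3 + z4 + z5 + z6 + z7 = 14 ->
  arc3_bad z0 z1 z2 z3 \/ arc3_bad z4 z5 z6 z7 ->
  arc3_bad z1 z2 z3 z4 \/ arc3_bad z5 z6 z7 z0 ->
  arc3_bad z2 z3 z4 z5 \/ arc3_bad z6 z7 z0 z1 ->
  arc3_bad z3 z4 z5 z6 \/ arc3_bad z7 z0 z1 z2 -> False.
Proof.
move=> ? ? ? ? ? ? ? ? ? b0 b1 b2 b3.
by case: b0 => -[? ? ? ? ?]; case: b1 => -[? ? ? ? ?]; case: b2 => -[? ? ? ? ?];
  case: b3 => -[? ? ? ? ?]; lra.
Qed.

(** * The cases d = 2 to 5 for periodic weights of total 14 *)

Section Arcs.
Context (R : realFieldType) (z : nat -> R) (P : Prop).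

Lemma arc_criterion_shift d i :
  arc_criterion d z P -> arc_criterion d (fun k => z (i + k)%N) P.
Proof.
move=> crit j c sc cz; apply: (crit (i + j)%N) => // k.
by rewrite -addnA; apply: cz.
Qed.

Lemma arc_criterion2 i c0 c1 c2 c3 : arc_criterion 2 z P ->
  0 <= c0 <= z i -> 0 <= c1 <= z i.+1 -> 0 <= c2 <= z i.+2 -> 0 <= c3 <= z i.+3 ->
  c0 + c1 + c2 + c3 = 7 -> c0 * c2 + c0 * c3 + c1 * c3 <= 98 / 25 -> P.
Proof.
move=> crit h0 h1 h2 h3 hs hc; apply: (crit i [:: c0; c1; c2; c3]) => //.
  by case=> [|[|[|[|//]]]] _; rewrite ?addnS addn0.
by rewrite !big_ord_recr big_ord0 /= add0r.
Qed.

Lemma arc_criterion3 i c0 c1 c2 c3 c4 : arc_criterion 3 z P ->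
  0 <= c0 <= z i -> 0 <= c1 <= z i.+1 -> 0 <= c2 <= z i.+2 -> 0 <= c3 <= z i.+3 ->
  0 <= c4 <= z i.+4 ->
  c0 + c1 + c2 + c3 + c4 = 7 -> c0 * c3 + c0 * c4 + c1 * c4 <= 98 / 25 -> P.
Proof.
move=> crit h0 h1 h2 h3 h4 hs hc; apply: (crit i [:: c0; c1; c2; c3; c4]) => //.
  by case=> [|[|[|[|[|//]]]]] _; rewrite ?addnS addn0.
by rewrite !big_ord_recr big_ord0 /= add0r.
Qed.

Lemma arc_criterion4 i c0 c1 c2 c3 c4 c5 : arc_criterion 4 z P ->
  0 <= c0 <= z i -> 0 <= c1 <= z i.+1 -> 0 <= c2 <= z i.+2 -> 0 <= c3 <= z i.+3 ->
  0 <= c4 <= z i.+4 -> 0 <= c5 <= z i.+4.+1 ->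
  c0 + c1 + c2 + c3 + c4 + c5 = 7 -> c0 * c4 + c0 * c5 + c1 * c5 <= 98 / 25 -> P.
Proof.
move=> crit h0 h1 h2 h3 h4 h5 hs hc; apply: (crit i [:: c0; c1; c2; c3; c4; c5]) => //.
  by case=> [|[|[|[|[|[|//]]]]]] _; rewrite ?addnS addn0.
by rewrite !big_ord_recr big_ord0 /= add0r.
Qed.

Lemma sparse_half2 :
  (forall i, z (i + 5)%N = z i) -> (forall i, 0 <= z i) ->
  (forall i, \sum_(k < 5) z (i + k)%N = 14) ->
  (forall i, 5 <= \sum_(k < 2) z (i + k)%N) ->
  arc_criterion 2 z P -> P.
Proof.
move=> per z0 tot deg crit.
have {}tot i : z i + z i.+1 + z i.+2 + z i.+3 + z i.+4 = 14.
  by rewrite -(tot i) !big_ord_recr big_ord0 /= add0r !addnS addn0.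
have {}deg i : 5 <= z i + z i.+1.
  by have := deg i; rewrite !big_ord_recr big_ord0 /= add0r !addnS addn0.
have {}per i : z i.+4.+1 = z i by rewrite -[RHS]per !addnS addn0.
have H i : P \/ 98 / 25 < z i * (7 - z i - z i.+1).
  have := (tot i, deg i.+1, deg i.+3, per i, z0 i, z0 i.+1, z0 i.+2, z0 i.+3, z0 i.+4).
  move=> [[[[[[[[t d1] d3] p] y0] y1] y2] y3] y4].
  have [h1|h1] := lerP 7 (z i + z i.+1).
    left; apply: (arc_criterion2 (i := i) (c0 := z i) (c1 := 7 - z i) (c2 := 0) (c3 := 0) crit);
      rewrite ?mulr0 ?addr0; lra.
  (* Consecutive vertices are not adjacent, so two of them weighing 7 carry a half without edges. If
     the pair i+3, i+4 is lighter, the vertices i, i+1, i+2 weigh more than 7 and the third one can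
     complete the half. *)
  have [h2|h2] := lerP 7 (z i.+3 + z i.+4).
    have d4 := deg i.+4; have y5 := z0 i.+3.+3.
    left; apply: (arc_criterion2 (i := i.+3) (c0 := z i.+3) (c1 := 7 - z i.+3) (c2 := 0)
      (c3 := 0) crit);
      rewrite ?mulr0 ?addr0; lra.
  have [h|h] := lerP (z i * (7 - z i - z i.+1)) (98 / 25); [left | by right].
  by apply: (arc_criterion2 (i := i) (c0 := z i) (c1 := z i.+1) (c2 := 7 - z i - z i.+1)
    (c3 := 0) crit);
    rewrite ?mulr0 ?addr0; lra.
have [//|b0] := H 0%N; have [//|b1] := H 1%N; have [//|b2] := H 2%N.
have [//|b3] := H 3%N; have [//|b4] := H 4%N.
have t := tot 0%N; rewrite (per 0%N) in b4.
set a := z 0%N in t b0 b1 b2 b3 b4; set b := z 1%N in t b0 b1 b2 b3 b4.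
set c := z 2%N in t b0 b1 b2 b3 b4; set d := z 3%N in t b0 b1 b2 b3 b4.
set e := z 4%N in t b0 b1 b2 b3 b4.
(* The five edge sums add up to 98 minus half the sum of the squares of the consecutive sums. Those
   have mean 28/5, so the total is at most 98/5 = 5 * 98/25, against the strict bounds. *)
have := sqr_ge0 (a + b - 28 / 5); have := sqr_ge0 (b + c - 28 / 5).
have := sqr_ge0 (c + d - 28 / 5); have := sqr_ge0 (d + e - 28 / 5).
have := sqr_ge0 (e + a - 28 / 5).
lra.
Qed.

Lemma sparse_half3 :
  (forall i, z (i + 8)%N = z i) ->
  (forall i, \sum_(k < 8) z (i + k)%N = 14) ->
  (forall i, 5 <= \sum_(k < 3) z (i + k)%N) ->
  arc_criterion 3 z P -> P.
Proof.
move=> per tot deg crit.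
have {}tot i : z i + z i.+1 + z i.+2 + z i.+3 + z i.+4 + z i.+4.+1 + z i.+4.+2 + z i.+4.+3 = 14.
  by rewrite -(tot i) !big_ord_recr big_ord0 /= add0r !addnS addn0.
have {}deg i : 5 <= z i + z i.+1 + z i.+2.
  by have := deg i; rewrite !big_ord_recr big_ord0 /= add0r !addnS addn0.
have {}per i : z i.+4.+4 = z i by rewrite -[RHS]per !addnS addn0.
(* The arcs of length 3 from i, i+3 and i+6 cover the cycle and meet only in i, so 15 <= 14 + z i.
   The same covering serves d = 4 (light case) and d = 5. *)
have z1 i : 1 <= z i.
  have := (tot i.+1, deg i, deg i.+3, deg i.+4.+2, per i) => -[[[[]]]]; lra.
have pair i : z i + z i.+1 <= 4.
  have := (tot i, deg i.+2, deg i.+4.+1) => -[[]]; lra.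
have H i : 7 <= z i + z i.+1 + z i.+2 + z i.+3 -> P \/ arc3_bad (z i) (z i.+1) (z i.+2) (z i.+3).
  move=> h.
  have := (z1 i, z1 i.+1, z1 i.+2, z1 i.+3, z1 i.+4, pair i, pair i.+1, pair i.+2).
  move=> [[[[[[[y0 y1] y2] y3] y4] p0] p1] p2].
  have [l|l] := lerP (z i * (7 - z i - z i.+1 - z i.+2)) (98 / 25).
    left; apply: (arc_criterion3 (i := i) (c0 := z i) (c1 := z i.+1) (c2 := z i.+2)
      (c3 := 7 - z i - z i.+1 - z i.+2) (c4 := 0) crit); rewrite ?mulr0 ?addr0; lra.
  have [r|r] := lerP (z i.+3 * (7 - z i.+1 - z i.+2 - z i.+3)) (98 / 25).
    left; apply: (arc_criterion3 (i := i) (c0 := 7 - z i.+1 - z i.+2 - z i.+3) (c1 := z i.+1)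
      (c2 := z i.+2) (c3 := z i.+3) (c4 := 0) crit); rewrite ?mulr0 ?addr0; lra.
  have d0 := deg i; have d1 := deg i.+1.
  have l0 : 0 <= z i by lra.
  have r0 : 0 <= z i.+3 by lra.
  have lt0 : 0 <= 7 - z i - z i.+1 - z i.+2 by lra.
  have rt0 : 0 <= 7 - z i.+1 - z i.+2 - z i.+3 by lra.
  (* The degree bound makes the truncated end at most 2, so the near tangents bound the full ends
     below and the middle pair above; the far tangents are the last two inequalities of
     [arc3_bad]. *)
  have ls := tangent_near_l l l0 lt0; have lt := tangent_near_r l l0 lt0.
  have lf := tangent_far l l0 lt0.
  have rs := tangent_near_l r r0 rt0; have rf := tangent_far r r0 rt0.
  by right; clear -d0 d1 p0 y1 ls lt lf rs rf; split; lra.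
have {}H i : P \/ (arc3_bad (z i) (z i.+1) (z i.+2) (z i.+3)
    \/ arc3_bad (z i.+4) (z i.+4.+1) (z i.+4.+2) (z i.+4.+3)).
  have t := tot i; have [/H|h] := lerP 7 (z i + z i.+1 + z i.+2 + z i.+3); first tauto.
  have /H : 7 <= z i.+4 + z i.+4.+1 + z i.+4.+2 + z i.+4.+3 by lra.
  tauto.
have [//|b0] := H 0%N; have [//|b1] := H 1%N; have [//|b2] := H 2%N; have [//|b3] := H 3%N.
rewrite ?(per 0%N) ?(per 1%N) ?(per 2%N) in b1 b2 b3.
by case: (arc3_bad_absurd (z1 0%N) (z1 1%N) (z1 2%N) (z1 3%N) (z1 4%N) (z1 5%N) (z1 6%N)
  (z1 7%N) (tot 0%N) b0 b1 b2 b3).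
Qed.

Lemma sparse_half4_heavy :
  (forall i, z (i + 11)%N = z i) ->
  (forall i, \sum_(k < 11) z (i + k)%N = 14) ->
  (forall i, 5 <= \sum_(k < 4) z (i + k)%N) ->
  arc_criterion 4 z P ->
  7 <= z 0%N + z 1%N + z 2%N + z 3%N + z 4%N -> P.
Proof.
move=> per tot deg crit heavy.
have {}tot i : z i + z i.+1 + z i.+2 + z i.+3 + z i.+4 + z i.+4.+1 + z i.+4.+2
    + z i.+4.+3 + z i.+4.+4 + z i.+4.+4.+1 + z i.+4.+4.+2 = 14.
  by rewrite -(tot i) !big_ord_recr big_ord0 /= add0r !addnS addn0.
have {}deg i : 5 <= z i + z i.+1 + z i.+2 + z i.+3.
  by have := deg i; rewrite !big_ord_recr big_ord0 /= add0r !addnS addn0.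
have {}per i : z i.+4.+4.+3 = z i by rewrite -[RHS]per !addnS addn0.
have triple i : z i + z i.+1 + z i.+2 <= 4.
  have := (tot i, deg i.+3, deg i.+4.+3) => -[[]]; lra.
have z1 i : 1 <= z i.
  have := (triple i.+1, deg i) => -[]; lra.
have z2 i : z i <= 2.
  have := (triple i, z1 i.+1, z1 i.+2) => -[[]]; lra.
have t := tot 0%N; have p0 := per 0%N; have p1 := per 1%N.
have [l|l] := lerP (z 0%N * (7 - z 0%N - z 1%N - z 2%N - z 3%N)) (98 / 25).
  have := (z1 0%N, z1 1%N, z1 2%N, z1 3%N, z1 5%N, z2 0%N, z2 1%N, z2 2%N, z2 3%N, triple 0%N).
  move=> [[[[[[[[[]]]]]]]]] *.
  apply: (arc_criterion4 (i := 0%N) (c0 := z 0%N) (c1 := z 1%N) (c2 := z 2%N) (c3 := z 3%N)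
    (c4 := 7 - z 0%N - z 1%N - z 2%N - z 3%N) (c5 := 0) crit); rewrite ?mulr0 ?addr0; lra.
have [r|r] := lerP (z 4%N * (7 - z 1%N - z 2%N - z 3%N - z 4%N)) (98 / 25).
  have := (z1 4%N, z1 1%N, z1 2%N, z1 3%N, z1 5%N, z2 4%N, z2 1%N, z2 2%N, z2 3%N, triple 1%N).
  move=> [[[[[[[[[]]]]]]]]] *.
  apply: (arc_criterion4 (i := 0%N) (c0 := 7 - z 1%N - z 2%N - z 3%N - z 4%N) (c1 := z 1%N)
    (c2 := z 2%N) (c3 := z 3%N) (c4 := z 4%N) (c5 := 0) crit); rewrite ?mulr0 ?addr0; lra.
have d0 := deg 0%N; have d1 := deg 1%N.
have [Z0 T0] : 49 / 25 < z 0%N /\ z 0%N + z 1%N + z 2%N + z 3%N < 126 / 25.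
  have y0 : 0 <= z 0%N by have := z1 0%N; lra.
  have y2 := z2 0%N.
  have t0 : 0 <= 7 - z 0%N - z 1%N - z 2%N - z 3%N by have := (triple 0%N, z2 3%N) => -[]; lra.
  have ls := tangent_near_l l y0 t0; have lt := tangent_near_r l y0 t0.
  by clear -d0 y2 ls lt; split; lra.
have [Z4 T4] : 49 / 25 < z 4%N /\ z 1%N + z 2%N + z 3%N + z 4%N < 126 / 25.
  have y0 : 0 <= z 4%N by have := z1 4%N; lra.
  have y2 := z2 4%N.
  have t0 : 0 <= 7 - z 1%N - z 2%N - z 3%N - z 4%N by have := triple 1%N; lra.
  have rs := tangent_near_l r y0 t0; have rt := tangent_near_r r y0 t0.
  by clear -d1 y2 rs rt; split; lra.
clear l r d0 d1 heavy.
(* As z 7 + z 8 <= 3, one of them is at most 3/2. The reflection j -> 4 - j preserves the heavy arc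
   and swaps 7 and 8: the arc from 7 to 1 serves the first case, the arc from 3 to 8 the second. *)
have [y7|y7] := lerP (z 7%N) (3 / 2).
  have := (z1 7%N, z1 8%N, z1 9%N, z1 10%N, z1 1%N, z2 0%N, triple 7%N,
    triple 8%N, triple 4%N, deg 7%N).
  move=> [[[[[[[[[]]]]]]]]] *.
  have [h|h] := lerP 7 (z 7%N + z 8%N + z 9%N + z 10%N + z 0%N).
    apply: (arc_criterion4 (i := 7%N) (c0 := z 7%N) (c1 := z 8%N) (c2 := z 9%N) (c3 := z 10%N)
      (c4 := 7 - z 7%N - z 8%N - z 9%N - z 10%N) (c5 := 0) crit); rewrite ?mulr0 ?addr0; try lra.
    have : z 7%N * (7 - z 7%N - z 8%N - z 9%N - z 10%N) <= 3 / 2 * 2 by apply: ler_pM; lra.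
    lra.
  (* The vertices 1 to 4 weigh less than 126/25 and z 5 + z 6 <= 4 - z 4 < 51/25, so [t'] is below
     2/25. The edge sum is then at most 3 + 3/5 < 98/25. *)
  pose t' := 7 - z 7%N - z 8%N - z 9%N - z 10%N - z 0%N.
  apply: (arc_criterion4 (i := 7%N) (c0 := z 7%N) (c1 := z 8%N) (c2 := z 9%N) (c3 := z 10%N)
    (c4 := z 0%N) (c5 := t') crit); rewrite /t'; try lra.
  have : z 7%N * z 0%N <= 3 / 2 * 2 by apply: ler_pM; lra.
  have : (z 7%N + z 8%N) * t' <= 3 * (1 / 5) by apply: ler_pM; rewrite /t'; lra.
  rewrite /t'; lra.
have := (z1 7%N, z1 8%N, z1 9%N, z1 5%N, z1 6%N, z1 3%N, z2 4%N, triple 7%N,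
  triple 5%N, triple 9%N, deg 5%N).
move=> [[[[[[[[[[]]]]]]]]]] *.
have [h|h] := lerP 7 (z 4%N + z 5%N + z 6%N + z 7%N + z 8%N).
  apply: (arc_criterion4 (i := 3%N) (c0 := 0) (c1 := 7 - z 5%N - z 6%N - z 7%N - z 8%N)
    (c2 := z 5%N) (c3 := z 6%N) (c4 := z 7%N) (c5 := z 8%N) crit); rewrite ?mul0r ?add0r; try lra.
  have : (7 - z 5%N - z 6%N - z 7%N - z 8%N) * z 8%N <= 2 * (3 / 2) by apply: ler_pM; lra.
  lra.
pose t' := 7 - z 4%N - z 5%N - z 6%N - z 7%N - z 8%N.
apply: (arc_criterion4 (i := 3%N) (c0 := t') (c1 := z 4%N) (c2 := z 5%N) (c3 := z 6%N)
  (c4 := z 7%N) (c5 := z 8%N) crit); rewrite /t'; try lra.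
have : z 4%N * z 8%N <= 2 * (3 / 2) by apply: ler_pM; lra.
have : (z 7%N + z 8%N) * t' <= 3 * (1 / 5) by apply: ler_pM; rewrite /t'; lra.
rewrite /t'; lra.
Qed.

Lemma sparse_half4_light :
  (forall i, z (i + 11)%N = z i) ->
  (forall i, \sum_(k < 11) z (i + k)%N = 14) ->
  (forall i, 5 <= \sum_(k < 4) z (i + k)%N) ->
  arc_criterion 4 z P ->
  (forall i, z i + z i.+1 + z i.+2 + z i.+3 + z i.+4 < 7) -> P.
Proof.
move=> per tot deg crit light.
have {}tot i : z i + z i.+1 + z i.+2 + z i.+3 + z i.+4 + z i.+4.+1 + z i.+4.+2
    + z i.+4.+3 + z i.+4.+4 + z i.+4.+4.+1 + z i.+4.+4.+2 = 14.
  by rewrite -(tot i) !big_ord_recr big_ord0 /= add0r !addnS addn0.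
have {}deg i : 5 <= z i + z i.+1 + z i.+2 + z i.+3.
  by have := deg i; rewrite !big_ord_recr big_ord0 /= add0r !addnS addn0.
have {}per i : z i.+4.+4.+3 = z i by rewrite -[RHS]per !addnS addn0.
have z1 i : 1 <= z i.
  have := (tot i.+1, deg i, deg i.+4, deg i.+4.+4, per i) => -[[[[]]]]; lra.
have H i : P \/ 98 / 25 < z i * z i.+4 +
    (z i + z i.+1) * (7 - z i - z i.+1 - z i.+2 - z i.+3 - z i.+4).
  set t := 7 - z i - z i.+1 - z i.+2 - z i.+3 - z i.+4.
  have [l|] := lerP (z i * z i.+4 + (z i + z i.+1) * t) (98 / 25); [left | by right].
  (* Lightness at i makes [t] positive; lightness of the complementary arc from i+6 makes it less
     than z (i+5). *)
  have := (light i, light i.+4.+2, tot i, z1 i, z1 i.+1, z1 i.+2, z1 i.+3, z1 i.+4).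
  move=> [[[[[[[]]]]]]] *.
  by apply: (arc_criterion4 (i := i) (c0 := z i) (c1 := z i.+1) (c2 := z i.+2) (c3 := z i.+3)
    (c4 := z i.+4) (c5 := t) crit); rewrite /t in l *; lra.
pose y i := z i - 1.
have yy i j : 0 <= y i * y j by rewrite mulr_ge0 // /y subr_ge0.
have [//|b0] := H 0%N; have [//|b1] := H 1%N; have [//|b2] := H 2%N.
have [//|b3] := H 3%N; have [//|b4] := H 4%N; have [//|b5] := H 5%N.
have [//|b6] := H 6%N; have [//|b7] := H 7%N; have [//|b8] := H 8%N.
have [//|b9] := H 9%N; have [//|b10] := H 10%N.
have t := tot 0%N.
rewrite ?(per 0%N) ?(per 1%N) ?(per 2%N) ?(per 3%N) in b0 b1 b2 b3 b4 b5 b6 b7 b8 b9 b10.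
(* With y = z - 1, the eleven edge sums add up to 43 minus this nonnegative
   form, and 43 < 11 * 98/25. *)
have c0 : 0 <= 2 * \sum_(i < 11) y i * y i + 3 * \sum_(i < 11) y i * y i.+1
     + 2 * \sum_(i < 11) y i * y i.+2 + 2 * \sum_(i < 11) y i * y i.+3.
  by rewrite !addr_ge0 // mulr_ge0 // sumr_ge0.
rewrite !big_ord_recr !big_ord0 /= /y ?(per 0%N) ?(per 1%N) ?(per 2%N) in c0.
clear -b0 b1 b2 b3 b4 b5 b6 b7 b8 b9 b10 t c0.
by exfalso; lra.
Qed.

Lemma sparse_half5 :
  (forall i, z (i + 14)%N = z i) ->
  (forall i, \sum_(k < 14) z (i + k)%N = 14) ->
  (forall i, 5 <= \sum_(k < 5) z (i + k)%N) ->
  arc_criterion 5 z P -> P.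
Proof.
move=> per tot deg crit.
have z1 i : 1 <= z i.
  have := (tot i.+1, deg i, deg (i + 5)%N, deg (i + 10)%N, per i) => -[[[[]]]].
  by rewrite !big_ord_recr !big_ord0 /= !addnS !addn0; lra.
(* Three edges between unit weights cost 3 <= 98/25. *)
apply: (crit 0%N (nseq 7 1)) => //.
- by move=> k k7; rewrite nth_nseq k7 z1 ler01.
- by rewrite !big_ord_recr big_ord0 /=; lra.
- by rewrite /=; lra.
Qed.
End Arcs.

(** * The case d = 1 and the passage from F_d to periodic weights *)

(** For d = 1, where F_1 is a single edge, too small for an arc of d + 2 vertices: a half
    concentrated on one vertex meets no edge. *)
Lemma heavy_vertex_sparse_half (R : realType) (V : finType) (E : rel V) (w : V -> R) (v0 : V) :
  irreflexive E -> symmetric E -> (forall v, 0 <= w v) -> 1 / 2 <= w v0 ->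
  exists s, is_sparse_half E w s.
Proof.
move=> Eirr Esym w0 wv0; exists (fun v => if v == v0 then 1 / 2 else 0); split; first split.
- by move=> v; case: eqP => [->|_]; rewrite ?w0 ?lexx //; lra.
- by rewrite -big_mkcond big_pred1_eq.
rewrite edge_sum // big1 ?mul0r => [|u _]; first lra.
rewrite big1 // => v Euv; case: eqP Euv => [->|]; last by rewrite mul0r.
by case: eqP => [->|]; rewrite ?Eirr ?mulr0.
Qed.

Lemma cyc_arc_criterion (R : realType) (d : nat) (npos : (0 < 3 * d - 1)%N)
    (w : 'I_(3 * d - 1) -> R) :
  (2 <= d)%N -> (forall v, 0 <= w v) ->
  arc_criterion d (fun j => 14 * cyc npos w j) (exists s, is_sparse_half (@F_adj d) w s).
Proof.
move=> d2 w0 i c sc cw c_sum cost.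
have cE k : (map (fun a => a / 14) c)`_k = c`_k / 14.
  have [h|h] := ltnP k (size c); first by rewrite (nth_map 0).
  by rewrite !nth_default ?size_map ?mul0r.
apply: (arc_sparse_half (npos := npos) (i := i) (c := map (fun a => a / 14) c)) => //.
- by rewrite size_map.
- by move=> k /cw; rewrite cE; lra.
- by under eq_bigr => k _ do rewrite cE; rewrite -mulr_suml c_sum; lra.
- by rewrite !cE; lra.
Qed.

Lemma cyc_total (R : realType) (n : nat) (npos : (0 < n)%N) (w : 'I_n -> R) (i : nat) :
  \sum_(k < n) cyc npos w (i + k) = \sum_v w v.
Proof. by rewrite [RHS](reindex_inj (@rot_ord_inj _ i npos)). Qed.

Lemma cyc_degree (R : realType) (d : nat) (npos : (0 < 3 * d - 1)%N)
    (w : 'I_(3 * d - 1) -> R) (c : R) (i : nat) :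
  min_degree_ge (@F_adj d) w c -> c <= \sum_(k < d) cyc npos w (i + k).
Proof.
(* The neighbourhood of v_j starts at j + d, and (i + 2d - 1) + d is i modulo 3d - 1. *)
move=> /(_ (Ordinal (ltn_pmod (i + (2 * d - 1)) npos))).
rewrite nbhd_cyc /=; under eq_bigr => k _.
  have -> : cyc npos w ((i + (2 * d - 1)) %% (3 * d - 1) + d + k) = cyc npos w (i + k).
    rewrite -(cycD npos w (i + k)); congr w; apply/val_inj => /=.
    by rewrite -addnA modnDml; congr (_ %% _)%N; lia.
  over.
by [].
Qed.

Theorem theorem3p1 (R : realType) (d : nat) (hd : (1 <= d <= 5)%N)
    (omega : 'I_(3 * d - 1) -> R)
    (homega : is_weight omega)
    (hdeg : min_degree_ge (@F_adj d) omega (5 / 14)) :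
  exists s : 'I_(3 * d - 1) -> R, is_sparse_half (@F_adj d) omega s.
Proof.
have npos : (0 < 3 * d - 1)%N by lia.
case: homega => [w01 wtot].
have w0 v : 0 <= omega v by have /andP[/ltW] := w01 v.
pose z j := 14 * cyc npos omega j.
have z0 j : 0 <= z j by rewrite mulr_ge0 ?ler0n ?w0.
have per i : z (i + (3 * d - 1))%N = z i by rewrite /z cycD.
have tot i : \sum_(k < 3 * d - 1) z (i + k)%N = 14.
  by rewrite -mulr_sumr cyc_total wtot mulr1.
have deg i : 5 <= \sum_(k < d) z (i + k)%N.
  by have := cyc_degree npos i hdeg; rewrite -mulr_sumr; lra.
have crit : (2 <= d)%N -> arc_criterion d z (exists s, is_sparse_half (@F_adj d) omega s).
  by move=> d2; apply: cyc_arc_criterion.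
case: d hd omega npos hdeg w01 wtot w0 @z z0 per tot deg crit =>
  [|[|[|[|[|[|d]]]]]] // _ w npos _ _ wtot w0 z z0 per tot deg crit.
- have : 1 / 2 <= w ord0 \/ 1 / 2 <= w ord_max.
    have := wtot; rewrite big_ord_recl big_ord1.
    have -> : lift ord0 ord0 = ord_max :> 'I_2 by apply/val_inj.
    by case: (lerP (1 / 2) (w ord0)) => h e; [left | right; lra].
  by case; apply: heavy_vertex_sparse_half => //;
    do [exact: F_adj_irr | exact: F_adj_sym].
- exact: (sparse_half2 per z0 tot deg (crit isT)).
- exact: (sparse_half3 per tot deg (crit isT)).
- have [[i h]|/forallNP h] :=
    pselect (exists i, 7 <= z i + z i.+1 + z i.+2 + z i.+3 + z i.+4).
  + apply: (sparse_half4_heavy (z := fun k => z (i + k)%N)) => [j|j|j||].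
    * by rewrite addnA per.
    * by under eq_bigr => k _ do rewrite addnA; apply: tot.
    * by under eq_bigr => k _ do rewrite addnA; apply: deg.
    * exact: arc_criterion_shift (crit isT).
    * by rewrite !addnS addn0.
  + apply: (sparse_half4_light per tot deg (crit isT)) => i.
    by rewrite ltNge; apply/negP/h.
- exact: (sparse_half5 per tot deg (crit isT)).
Qed.
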